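(* Let $G$ be a finite directed positively weighted graph. The canonical antilorentzian spectral spacetime on $G$ (as defined in the context) is stably causal if and only if $G$ is acyclic, i.e. contains no directed cycle.
   Context: **Graph.** $G=(V,E,s,t,\delta)$: a finite simple undirected graph $(V,E)$ (no loops, at most one edge between two vertices, not necessarily connected), with an orientation of each edge given by source/target maps $s,t:E\to V$, and weights $\delta_e>0$. Write $e^-=s(e)$, $e^+=t(e)$. **Canonical antilorentzian spectral spacetime.** $\mathcal A$ is the algebra of complex functions on $V$. $H=\mathbb{C}^E\otimes\mathbb{C}^2=\bigoplus_{e\in E}\mathbb{C}^2$ with its canonical scalar product $\langle\cdot,\cdot\rangle$, each summand $\mathbb{C}^2$ having basis $(-,+)$. Let $\theta_e\in\mathbb{R}$ be arbitrary phases (immaterial up to unitary equivalence). Set $$\pi(a)=\bigoplus_{e}\begin{pmatrix}a(e^-)&0\\ 0&a(e^+)\end{pmatrix},\quad D=\bigoplus_e\frac1{\delta_e}\begin{pmatrix}0&e^{i\theta_e}\\ e^{-i\theta_e}&0\end{pmatrix},\quad \omega=\bigoplus_e\begin{pmatrix}0&ie^{i\theta_e}\\ -ie^{-i\theta_e}&0\end{pmatrix}.$$ The canonical spectral spacetime is $(\mathcal A,H,(\cdot,\cdot)_\omega,\pi,D_\omega,J_\omega,\chi)$ with Krein product $(F,G)_\omega=\langle F,\omega G\rangle$, Dirac operator $D_\omega=-iD$, charge conjugation $J_\omega=\bigoplus_e\begin{pmatrix}0&-1\\ 1&0\end{pmatrix}\circ\text{(complex conjugation)}$, and grading $\chi$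 equal, up to an irrelevant overall sign, to $(\chi F)(e,\pm)=\pm F(e,\pm)$. **Stable causality.** Let $\times$ be the adjoint for $(\cdot,\cdot)_\omega$. Noncommutative 1-forms are finite sums $\sum_i\pi(a_i)[D_\omega,\pi(b_i)]$, $a_i,b_i\in\mathcal A$. A positive time-orientation 1-form is a 1-form $\beta$ with $\beta^\times=\beta$, $J_\omega\beta J_\omega^{-1}=-\beta$, and $(\cdot,\beta^{-1}\cdot)_\omega$ positive definite. A 1-form is exact if it equals $[D_\omega,\pi(a)]$ for some $a\in\mathcal A$ (scalar factors being absorbed in $a$). The spectral spacetime is stably causal if there exists an exact positive time-orientation 1-form. *)

(* Defs.v *)
From HB Require Import structures.
From mathcomp Require Import all_boot all_order all_algebra.
From mathcomp Require Import complex.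
From mathcomp Require Import reals trigo.

Set Implicit Arguments.
Unset Strict Implicit.
Unset Printing Implicit Defensive.

Import Order.TTheory GRing.Theory Num.Theory.
Local Open Scope ring_scope.
Local Open Scope complex_scope.

(* [edge_unique]: two distinct edges never have the same two endpoints, whatever
   their orientations; in particular antiparallel edges are excluded. *)
Record wdigraph (R : realType) := Wdigraph {
  vertex : finType;
  edge : finType;
  src : edge -> vertex;
  tgt : edge -> vertex;
  weight : edge -> R;
  loopless : forall e, src e != tgt e;
  edge_unique : forall e f,
    [set src e; tgt e] = [set src f; tgt f] -> e = f;
  weight_gt0 : forall e, 0 < weight e
}.

Definition arc (R : realType) (G : wdigraph R) : rel (vertex G) :=
  fun v w => [exists e : edge G, (src e == v) && (tgt e == w)].

Definition acyclic (R : realType) (G : wdigraph R) : Prop :=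
  ~ exists2 c : seq (vertex G), c != [::] & ucycle (@arc R G) c.

(* The data (A, H, (.,.), pi, D, J, chi) on a finite-dimensional space, with the
   inverse of J. [alg] is only required to be a possibly trivial ring, so that
   functions on an empty vertex set are allowed. *)
Record spectral_data (R : realType) := SpectralData {
  alg : pzRingType;
  space : vectType R[i];
  krein : space -> space -> R[i];
  rep : alg -> 'End(space);
  dirac : 'End(space);
  conjop : space -> space;
  conjop_inv : space -> space;
  conjopK : cancel conjop conjop_inv;
  conjop_invK : cancel conjop_inv conjop;
  grading : 'End(space)
}.

Section StableCausality.
Variables (R : realType) (S : spectral_data R).
Implicit Types (beta T : 'End(space S)) (a b : alg S).

Definition dcomm b : 'End(space S) :=
  (dirac S \o rep b)%VF - (rep b \o dirac S)%VF.

Definition one_form beta : Prop :=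
  exists (n : nat) (a b : 'I_n -> alg S),
    beta = \sum_(i < n) (rep (a i) \o dcomm (b i))%VF.

Definition exact_form beta : Prop := exists a, beta = dcomm a.

Definition krein_adjoint T T' : Prop :=
  forall F G : space S, krein (T' F) G = krein F (T G).

(* On R[i], [0 < z] means that z is real and positive. *)
Definition positive_definite (q : space S -> space S -> R[i]) : Prop :=
  forall F, F != 0 -> 0 < q F F.

(* [(f^-1)%VF] is the inverse of f only when f is injective, whence the
   explicit [lker] condition. *)
Definition positive_time_orientation beta : Prop :=
  [/\ one_form beta,
      krein_adjoint beta beta,
      forall F, conjop (beta (conjop_inv F)) = - beta F,
      lker beta == 0%VS
    & positive_definite (fun F G => krein F ((beta^-1)%VF G))].

Definition stably_causal : Prop :=
  exists2 beta, exact_form beta & positive_time_orientation beta.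

End StableCausality.

Section BlockDiagonal.
Variables (R : realType) (E : finType).
Local Notation C := R[i].

Definition mx2 (a b c d : C) : 'M[C]_2 :=
  \matrix_(i, j) if i == 0 then (if j == 0 then a else b)
                 else (if j == 0 then c else d).

(* Coordinate 0 of each summand is the "-" component, coordinate 1 the "+"
   component. *)
Definition spinor : vectType C := {ffun E -> 'cV[C]_2}.

Definition block_fun (M : E -> 'M[C]_2) (F : spinor) : spinor :=
  [ffun e => M e *m F e].

Fact block_fun_is_linear M : linear (block_fun M).
Proof.
by move=> k F G; apply/ffunP => e; rewrite !ffunE mulmxDr -scalemxAr.
Qed.

HB.instance Definition _ M :=
  GRing.isLinear.Build R[i] spinor spinor _ (block_fun M)
    (block_fun_is_linear M).

Definition block_diag (M : E -> 'M[C]_2) : 'End(spinor) := linfun (block_fun M).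

Lemma block_diagE M F e : block_diag M F e = M e *m F e.
Proof. by rewrite lfunE /= ffunE. Qed.

Definition inner (F G : spinor) : C :=
  \sum_e \sum_k ((F e k 0)^*)%C * G e k 0.

Definition block_conj (M : 'M[C]_2) (F : spinor) : spinor :=
  [ffun e => M *m map_mx conjc (F e)].

Definition spinor_conj : spinor -> spinor := block_conj (mx2 0 (-1) 1 0).
Definition spinor_conj_inv : spinor -> spinor := block_conj (mx2 0 1 (-1) 0).

Fact block_conjK M N :
  M *m map_mx conjc N = 1%:M -> cancel (block_conj N) (block_conj M).
Proof.
move=> MN F; apply/ffunP => e; rewrite !ffunE map_mxM mulmxA MN mul1mx.
apply/matrixP => i j; rewrite !mxE; exact: conjcK.
Qed.

Fact spinor_conjK : cancel spinor_conj spinor_conj_inv.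
Proof.
apply: block_conjK; apply/matrixP => i j; rewrite !mxE !big_ord_recl big_ord0.
rewrite !mxE /=; case: i j => [[|[|[]]]] // ? [[|[|[]]]] // ? /=.
all: by apply/eqP; rewrite eq_complex /= !(mul0r, mulr0, mul1r, mulN1r,
  oppr0, opprK, subr0, add0r, addr0) !eqxx.
Qed.

Fact spinor_conj_invK : cancel spinor_conj_inv spinor_conj.
Proof.
apply: block_conjK; apply/matrixP => i j; rewrite !mxE !big_ord_recl big_ord0.
rewrite !mxE /=; case: i j => [[|[|[]]]] // ? [[|[|[]]]] // ? /=.
all: by apply/eqP; rewrite eq_complex /= !(mul0r, mulr0, mul1r, mulN1r,
  oppr0, opprK, subr0, add0r, addr0) !eqxx.
Qed.

End BlockDiagonal.

Section Canonical.
Variables (R : realType) (G : wdigraph R) (theta : edge G -> R).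
Local Notation H := (spinor R (edge G)).

Definition phase (x : R) : R[i] := cos x +i* sin x.

Definition graph_rep (a : {ffun vertex G -> R[i]}) : 'End(H) :=
  block_diag (fun e : edge G => mx2 (a (src e)) 0 0 (a (tgt e))).

Definition graph_D : 'End(H) :=
  block_diag (fun e : edge G =>
    ((weight e)^-1)%:C *: mx2 0 (phase (theta e)) (phase (- theta e)) 0).

Definition graph_omega : 'End(H) :=
  block_diag (fun e : edge G =>
    mx2 0 ('i%C * phase (theta e)) (- 'i%C * phase (- theta e)) 0).

Definition graph_krein (F K : H) : R[i] := inner F (graph_omega K).

Definition graph_grading : 'End(H) := block_diag (fun=> mx2 (-1) 0 0 1).

Definition canonical_spacetime : spectral_data R :=
  @SpectralData R {ffun vertex G -> R[i]} H graph_krein graph_rep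
    (- 'i%C *: graph_D) _ _ (@spinor_conjK R (edge G))
    (@spinor_conj_invK R (edge G)) graph_grading.

End Canonical.

(* Main.v *)
Require Import Defs.
From mathcomp Require Import all_boot all_order all_algebra.
From mathcomp Require Import complex reals.
From mathcomp Require Import trigo ring.

(** Write [c e = (a (src e) - a (tgt e)) / weight e] for the discrete derivative
    of a function [a] along the edges. On each edge the commutator of the Dirac
    operator with [a] is [c e] times the block of [omega] ([dcommE]): both are
    off-diagonal, with the same phase. As [omega] is a unitary involution, the
    Krein product of an exact form [beta] reduces to
    [(beta F, G) = \sum_e (c e)^* <F e, G e>], with no trace of the phases
    ([krein_dcomml], [krein_dcommr]). Consequently [beta] is a positive
    time-orientation exactly when every [c e] is real and positive, that is,
    when [a] strictly decreases along the edges for the order of the complex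
    numbers, in which comparable numbers have the same imaginary part
    ([time_orientationP]): testing positivity on a spinor carried by one edge
    isolates [c e], and conversely the reality and charge conjugation axioms
    ask no more than that [c] be real.

    It remains to see that such a time function exists if and only if the graph
    is acyclic. Along a directed cycle it would decrease and come back to its
    initial value ([decreasing_no_cycle]). On an acyclic graph, the number of
    vertices that can be reached from a given one is a time function: an arc
    from [v] to [w] makes everything reachable from [w] reachable from [v], but
    [v] itself is not reachable from [w], as a path back to [v] would close a
    directed cycle ([card_connect_lt]). *)

Set Implicit Arguments.
Unset Strict Implicit.
Unset Printing Implicit Defensive.

Import Order.TTheory GRing.Theory Num.Theory.
Local Open Scope ring_scope.
Local Open Scope complex_scope.

(** * Time functions of a finite relation *)

Section TimeFunction.

Lemma decreasing_no_cycle (d : Order.disp_t) (P : porderType d) (T : eqType)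
    (r : rel T) (a : T -> P) (c : seq T) :
  (forall v w, r v w -> (a w < a v)%O) -> c != [::] -> ~~ cycle r c.
Proof.
move=> ra; case: c => // v p _; apply/negP => /= rp.
have tr : transitive (fun v w => (a w < a v)%O).
  by move=> y x z xy yz; apply: lt_trans yz xy.
(* The closing arc puts [v] at the end of the path, hence below itself. *)
have /(order_path_min tr)/allP/(_ v) := sub_path ra rp.
by rewrite mem_rcons mem_head ltxx => /(_ isT).
Qed.

Lemma card_connect_lt (T : finType) (r : rel T) (v w : T) :
  ~ (exists2 c : seq T, c != [::] & ucycle r c) -> r v w ->
  (#|connect r w| < #|connect r v|)%N.
Proof.
move=> acyc rvw; apply/proper_card/properP; split.
  by apply/subsetP => x; apply: connect_trans (connect1 rvw).
exists v; first exact: connect0.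
apply/negP => /connectP[p rp vp]; apply: acyc.
case: (shortenP rp) vp => q rq uq _ vq.
(* A path from [w] back to [v], once made simple, is closed by the arc. *)
by exists (w :: q) => //; rewrite /ucycle /= rcons_path rq -vq rvw.
Qed.

End TimeFunction.

(** * The Hermitian product of one summand *)

Section Block.
Variable R : realType.
Local Notation C := R[i].
Implicit Types (u v : 'cV[C]_2) (c z : C).

Definition dotc u v : C := \sum_k ((u k 0)^*)%C * v k 0.

Lemma dotcE u v :
  dotc u v = ((u 0 0)^*)%C * v 0 0 + ((u 1 0)^*)%C * v 1 0.
Proof.
have E : lift ord0 ord0 = 1 :> 'I_2 by exact/val_inj.
by rewrite /dotc big_ord_recl big_ord1 E.
Qed.

Lemma dotcZl z u v : dotc (z *: u) v = (z^*)%C * dotc u v.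
Proof. by rewrite !dotcE !mxE !rmorphM /=; ring. Qed.

Lemma dotcZr z u v : dotc u (z *: v) = z * dotc u v.
Proof. by rewrite !dotcE !mxE; ring. Qed.

Lemma dotc_ge0 u : 0 <= dotc u u.
Proof. by apply: sumr_ge0 => k _; rewrite mulrC mulcJ_ge0. Qed.

Lemma dotc_eq0 u : (dotc u u == 0) = (u == 0).
Proof.
apply/idP/eqP => [|->]; last by rewrite dotcE !mxE !mulr0 addr0.
rewrite psumr_eq0 => [/allP u0|k _]; last by rewrite mulrC mulcJ_ge0.
apply/colP => k; rewrite mxE; apply/eqP.
by have := u0 k (mem_index_enum k); rewrite mulf_eq0 conjc_eq0 orbb.
Qed.

Lemma mx2_mulE (a b c d : C) u :
  ((mx2 a b c d *m u) 0 0 = a * u 0 0 + b * u 1 0) *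
  ((mx2 a b c d *m u) 1 0 = c * u 0 0 + d * u 1 0).
Proof.
have E : lift ord0 ord0 = 1 :> 'I_2 by exact/val_inj.
by split; rewrite mxE big_ord_recl big_ord1 E !mxE.
Qed.

Lemma colP2 u v : u 0 0 = v 0 0 -> u 1 0 = v 1 0 -> u = v.
Proof.
move=> uv0 uv1; apply/colP => k.
have [-> //|k0] := eqVneq k 0.
have -> : k = 1 by apply/val_inj; case: k k0 => [[|[|[]]]].
exact: uv1.
Qed.

Lemma dotc_unitary z u v : z * (z^*)%C = 1 ->
  dotc (mx2 0 z (z^*)%C 0 *m u) (mx2 0 z (z^*)%C 0 *m v) = dotc u v.
Proof.
move=> z1; rewrite !dotcE !mx2_mulE !mul0r !add0r !addr0 !rmorphM /= conjcK.
(* Each [1] on the right becomes [z * z^*]. *)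
rewrite -[in RHS](mul1r (_ * v 0 0)) -[in RHS](mul1r (_ * v 1 0)).
by rewrite -z1; ring.
Qed.

Lemma antidiag_sqr z u : z * (z^*)%C = 1 ->
  mx2 0 z (z^*)%C 0 *m (mx2 0 z (z^*)%C 0 *m u) = u.
Proof.
move=> z1; apply: colP2; rewrite !mx2_mulE !mul0r !add0r !addr0 mulrA.
  by rewrite z1 mul1r.
by rewrite (mulrC _ z) z1 mul1r.
Qed.

(** An antidiagonal Hermitian matrix anticommutes with the antilinear charge
    conjugation, and a real scalar commutes with it. *)
Lemma conj_antidiag z c u : (c^*)%C = c ->
  mx2 0 (-1) 1 0 *m map_mx conjc
    (c *: (mx2 0 z (z^*)%C 0 *m (mx2 0 1 (-1) 0 *m map_mx conjc u))) =
  - (c *: (mx2 0 z (z^*)%C 0 *m u)).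
Proof.
move=> creal; apply: colP2;
  rewrite !(mx2_mulE, mxE, mul0r, mul1r, mulN1r, add0r, addr0).
  by rewrite !(rmorphN, rmorphM) /= !conjcK creal; ring.
by rewrite !(rmorphN, rmorphM) /= creal (conjcK (u 0 0)); ring.
Qed.

End Block.

(** * Exact forms on the canonical spacetime *)

Section ExactForms.
Variables (R : realType) (G : wdigraph R) (theta : edge G -> R).
Local Notation C := R[i].
Local Notation S := (canonical_spacetime theta).
Local Notation H := (spinor R (edge G)).
Implicit Types (a : {ffun vertex G -> C}) (F K : H) (e : edge G).

Definition edge_diff a e : C := (a (src e) - a (tgt e)) / (weight e)%:C.

Lemma phaseN (x : R) : phase (- x) = ((phase x)^*)%C.
Proof. by rewrite /phase cosN sinN. Qed.

(** The upper entry of the block of [omega]; the lower one is its conjugate. *)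
Definition omega_phase e : C := 'i%C * phase (theta e).

Lemma omega_phaseC e : ((omega_phase e)^*)%C = - 'i%C * phase (- theta e).
Proof.
rewrite rmorphM phaseN; congr (_ * _).
by apply/eqP; rewrite eq_complex /= oppr0 !eqxx.
Qed.

Lemma omega_phase_unit e : omega_phase e * ((omega_phase e)^*)%C = 1.
Proof.
rewrite /omega_phase /phase; have cs := cos2Dsin2 (theta e).
apply/eqP; rewrite eq_complex /=; apply/andP; split; apply/eqP; last by ring.
by rewrite -[RHS]cs; ring.
Qed.

Lemma omegaE F e :
  graph_omega theta F e =
  mx2 0 (omega_phase e) ((omega_phase e)^*)%C 0 *m F e.
Proof.
rewrite block_diagE; congr (mx2 _ _ _ _ *m _).
by rewrite omega_phaseC.
Qed.

Lemma omegaK F : graph_omega theta (graph_omega theta F) = F.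
Proof.
by apply/ffunP => e; rewrite !omegaE antidiag_sqr // omega_phase_unit.
Qed.

(** The minus sign of the lower entry of [omega] is the one that the commutator
    with a diagonal matrix produces in the lower entry of the Dirac block, and
    the factor [-i] matches the phases; hence the source minus the target in
    [edge_diff]. *)
Lemma dcommE a F e :
  (@dcomm R S a) F e = edge_diff a e *: graph_omega theta F e.
Proof.
rewrite /dcomm add_lfunE opp_lfunE !comp_lfunE /= !scale_lfunE linearZ /=.
rewrite !ffunE omegaE !block_diagE /edge_diff -fmorphV.
rewrite omega_phaseC /omega_phase -!scalemxAl.
apply: colP2; rewrite !(mx2_mulE, mxE).
  by ring.
by ring.
Qed.

Lemma graph_rep1 : @graph_rep R G 1 = \1%VF.
Proof.
apply/lfunP => F; apply/ffunP => e; rewrite block_diagE id_lfunE !ffunE.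
by apply: colP2; rewrite !mx2_mulE !mul0r mul1r ?addr0 ?add0r.
Qed.

Lemma dcomm_one_form a : one_form (@dcomm R S a).
Proof.
exists 1%N, (fun=> 1), (fun=> a).
by rewrite big_ord1 /= graph_rep1 comp_lfun1l.
Qed.

(** The two blocks of [omega], one from the Krein product and one from the form,
    cancel by unitarity. *)
Lemma krein_dcomml a F K :
  @krein R S (@dcomm R S a F) K =
  \sum_e ((edge_diff a e)^*)%C * dotc (F e) (K e).
Proof.
apply: eq_bigr => e _; rewrite -/(dotc _ _) dcommE dotcZl !omegaE.
by rewrite dotc_unitary // omega_phase_unit.
Qed.

Lemma krein_dcommr a F K :
  @krein R S F (@dcomm R S a K) =
  \sum_e edge_diff a e * dotc (F e) (K e).
Proof.
apply: eq_bigr => e _; rewrite -/(dotc _ _) -dotcZr; congr dotc.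
by rewrite omegaE dcommE -scalemxAr -omegaE omegaK.
Qed.

Lemma conj_dcomm a F : (forall e, ((edge_diff a e)^*)%C = edge_diff a e) ->
  spinor_conj ((@dcomm R S a) (spinor_conj_inv F)) =
  - (@dcomm R S a) F.
Proof.
move=> creal; apply/ffunP => e; rewrite [LHS]ffunE [RHS]ffunE !dcommE !omegaE.
by rewrite [spinor_conj_inv F e]ffunE; apply: conj_antidiag.
Qed.

Lemma edge_diff_gt0 a e : (0 < edge_diff a e) = (a (tgt e) < a (src e)).
Proof. by rewrite pmulr_lgt0 ?subr_gt0 // invr_gt0 ltcR weight_gt0. Qed.

(** As [beta] is invertible, the positivity of the Krein form of [beta^-1] at
    [F = beta K] is that of the sum of the [(edge_diff a e)^* |K e|^2], a
    diagonal Hermitian form, for all nonzero [K]. *)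
Lemma time_orientationP a :
  positive_time_orientation (@dcomm R S a) <->
  forall e, a (tgt e) < a (src e).
Proof.
split=> [[_ _ _ ker0 pos] e|a_decr].
  (* A spinor carried by the edge [e] alone. *)
  pose K : H := [ffun f => if f == e then const_mx 1 else 0].
  have K0 : K != 0.
    apply/eqP => /ffunP/(_ e)/matrixP/(_ 0 0)/eqP.
    by rewrite !ffunE eqxx !mxE oner_eq0.
  have := pos ((@dcomm R S a) K).
  rewrite lker0_lfunK // krein_dcomml.
  rewrite -(inj_eq (lker0P ker0)) linear0 in K0 => /(_ K0).
  rewrite (bigD1 e) //= big1 ?addr0 => [|f /negPf fe]; last first.
    by rewrite /K ffunE fe dotcE !mxE !mulr0 addr0 mulr0.
  have d0 : 0 < dotc (K e) (K e).
    rewrite lt0r dotc_ge0 dotc_eq0 /K ffunE eqxx andbT.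
    by apply/eqP => /matrixP/(_ 0 0)/eqP; rewrite !mxE oner_eq0.
  by rewrite pmulr_lgt0 // lt0r conjc_eq0 conj_ge0 -lt0r edge_diff_gt0.
have c_gt0 e : 0 < edge_diff a e by rewrite edge_diff_gt0.
have creal e : ((edge_diff a e)^*)%C = edge_diff a e.
  by apply: (@geC0_conj R[i]); apply: ltW.
have ker0 : lker (@dcomm R S a) == 0%VS.
  apply/lker0P/raddf_inj => F F0; rewrite -(omegaK F).
  have -> : graph_omega theta F = 0; last by rewrite linear0.
  apply/ffunP => e; have /ffunP/(_ e)/eqP := F0.
  rewrite dcommE [in X in _ == X]ffunE scaler_eq0 gt_eqF //= [RHS]ffunE.
  by move/eqP.
split=> //.
- exact: dcomm_one_form.
- move=> F K; rewrite krein_dcomml krein_dcommr.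
  by apply: eq_bigr => e _; rewrite creal.
- by move=> F; apply: conj_dcomm.
move=> F F0; have := lker0_lfunVK ker0 F.
set K := (_^-1)%VF F => defF; rewrite -defF krein_dcomml.
have K0 : K != 0 by apply: contra_neq F0 => K0; rewrite -defF K0 linear0.
have term_ge0 e : 0 <= (edge_diff a e)^*%C * dotc (K e) (K e).
  by rewrite creal mulr_ge0 ?dotc_ge0 // ltW.
rewrite lt0r sumr_ge0 // andbT psumr_eq0 //; apply: contra_neqN K0 => /allP K0.
apply/ffunP => e; have := K0 e (mem_index_enum e).
by rewrite creal mulf_eq0 gt_eqF //= dotc_eq0 ffunE => /eqP.
Qed.

End ExactForms.

Theorem proposition6 (R : realType) (G : wdigraph R) (theta : edge G -> R) :
  stably_causal (canonical_spacetime theta) <-> acyclic G.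
Proof.
split=> [[_ [a ->] /time_orientationP a_decr] [c c0 /andP[rc _]]|acyc].
  apply/negP: rc; apply: (decreasing_no_cycle (a := a)) c0 => v w.
  by case/existsP=> e /andP[/eqP<- /eqP<-].
pose a : {ffun vertex G -> R[i]} := [ffun v => #|connect (@Defs.arc R G) v|%:R].
exists (dcomm (S := canonical_spacetime theta) a); first by exists a.
apply/time_orientationP => e; rewrite !ffunE ltr_nat.
by apply: card_connect_lt => //; apply/existsP; exists e; rewrite !eqxx.
Qed.
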